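(* Let $\lambda_1,\lambda_2,\lambda_3,\lambda_4,\mu_1,\mu_3\in\mathbb{R}$ and let $(G,\varphi,\xi,\eta,g)$ be the 5-dimensional almost contact B-metric manifold described in the context, where $G$ is a connected real Lie group with left-invariant structure determined by these parameters. Then the $\varphi$B-connection $\nabla'$ of $(G,\varphi,\xi,\eta,g)$ is flat, i.e. its curvature tensor $R'$ vanishes identically.
   Context: $G$ is a 5-dimensional real connected Lie group with a global basis $\{e_1,\dots,e_5\}$ of left-invariant vector fields. The left-invariant structure $(\varphi,\xi,\eta,g)$ on $G$ is given by $$\varphi e_1=e_3,\quad \varphi e_2=e_4,\quad \varphi e_3=-e_1,\quad \varphi e_4=-e_2,\quad \varphi e_5=0,$$ $$\xi=e_5,\qquad \eta(e_i)=0\ (i=1,2,3,4),\quad \eta(e_5)=1,$$ $$g(e_1,e_1)=g(e_2,e_2)=-g(e_3,e_3)=-g(e_4,e_4)=g(e_5,e_5)=1,\qquad g(e_i,e_j)=0\ (i\neq j),$$ and the Lie brackets are $$[e_1,\xi]=\lambda_1e_1+\lambda_2e_2+\lambda_3e_3+\lambda_4e_4,$$ $$[e_2,\xi]=\mu_1e_1-\lambda_1e_2+\mu_3e_3-\lambda_3e_4,$$ $$[e_3,\xi]=-\lambda_3e_1-\lambda_4e_2+\lambda_1e_3+\lambda_2e_4,$$ $$[e_4,\xi]=-\mu_3e_1+\lambda_3e_2+\mu_1e_3-\lambda_1e_4,$$ with $[e_i,e_j]=0$ for $i,j\in\{1,2,3,4\}$. Let $\nabla$ be the Levi-Civita connection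 of $g$. The $\varphi$B-connection is the linear connection $$\nabla'_xy=\nabla_xy+\tfrac12\{(\nabla_x\varphi)\varphi y+(\nabla_x\eta)y\cdot\xi\}-\eta(y)\nabla_x\xi,$$ and its curvature tensor is $R'(x,y)z=\nabla'_x\nabla'_yz-\nabla'_y\nabla'_xz-\nabla'_{[x,y]}z$. *)

(* Defs.v *)
From HB Require Import structures.
From mathcomp Require Import all_boot all_order all_algebra.
From mathcomp Require Import all_classical all_reals all_analysis.
From mathcomp Require Import ring.

Set Implicit Arguments.
Unset Strict Implicit.
Unset Printing Implicit Defensive.

Import Order.TTheory GRing.Theory Num.Theory.
Import numFieldNormedType.Exports.

Local Open Scope classical_set_scope.
Local Open Scope ring_scope.

Section SmoothEuclidean.
Context {R : realType} {n : nat}.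
Implicit Types (U : set 'rV[R]_n) (f g : 'rV[R]_n -> R).

(* C^k on the open set U: all iterated partial derivatives of order <= k exist
   and are continuous on U. *)
Fixpoint Ck U (k : nat) f : Prop :=
  (forall x, U x -> {for x, continuous f}) /\
  if k is k'.+1 then
    forall i : 'I_n, (forall x, U x -> derivable f x (delta_mx 0 i)) /\
                     Ck U k' ('D_(delta_mx 0 i) f)
  else True.

Definition smooth_on U f : Prop := forall k, Ck U k f.

Definition smooth_map_on m U (F : 'rV[R]_n -> 'rV[R]_m) : Prop :=
  forall j : 'I_m, smooth_on U (fun x => F x 0 j).

Lemma Ck_eq U k f g : open U -> (forall x, U x -> f x = g x) ->
  Ck U k f -> Ck U k g.
Proof.
move=> oU fg; have nfg (h1 h2 : _ -> R) x : (forall y, U y -> h1 y = h2 y) -> U x ->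
    {near x, h1 =1 h2}.
  by move=> h Ux; apply: filterS (open_nbhs_nbhs (conj oU Ux)) => y; exact: h.
have cg (h1 h2 : _ -> R) : (forall y, U y -> h1 y = h2 y) ->
    (forall x, U x -> {for x, continuous h1}) ->
    forall x, U x -> {for x, continuous h2}.
  move=> h c1 x Ux; rewrite /prop_for /continuous_at -(h x Ux).
  by apply: cvg_trans (c1 x Ux); exact: (near_eq_cvg (F := nbhs x) (nfg _ _ _ h Ux)).
elim: k f g fg => [|k IH] f g fg [cf df].
  by split=> //; exact: cg fg cf.
split=> [|i]; first exact: cg fg cf.
have [d1 d2] := df i; split=> [x Ux|].
  by apply: (near_eq_derivable (nfg _ _ _ fg Ux)); exact: d1.
by apply: IH d2 => x Ux; apply: near_eq_derive; exact: nfg.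
Qed.

Lemma Ck_le U k f : Ck U k.+1 f -> Ck U k f.
Proof.
elim: k f => [|k IH] f [cf df]; split=> // i.
by have [d1 d2] := df i; split=> //; exact: IH.
Qed.

Lemma Ck_cst U k (c : R) : open U -> Ck U k (cst c).
Proof.
move=> oU; have cc (a : R) x : U x -> {for x, continuous (cst a : 'rV[R]_n -> R)}.
  by move=> _; exact: cst_continuous.
elim: k c => [|k IH] c; first by split=> //; exact: cc.
split=> [|i]; first exact: cc.
split=> [x _|]; first exact: derivable_cst.
by apply: (Ck_eq oU _ (IH 0)) => x _; rewrite derive_cst.
Qed.

Lemma CkD U k f g : open U -> Ck U k f -> Ck U k g -> Ck U k (f + g).
Proof.
move=> oU; elim: k f g => [|k IH] f g [cf df] [cg dg];
  (split=> [x Ux|]; first by apply: continuousD; [exact: cf|exact: cg]) => // i.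
have [d1 d2] := df i; have [e1 e2] := dg i.
split=> [x Ux|]; first by apply: derivableD; [exact: d1|exact: e1].
apply: (Ck_eq oU _ (IH _ _ d2 e2)) => x Ux.
by rewrite deriveD //; [exact: d1|exact: e1].
Qed.

Lemma CkM U k f g : open U -> Ck U k f -> Ck U k g -> Ck U k (f * g).
Proof.
move=> oU; elim: k f g => [|k IH] f g Cf Cg; have [cf df] := Cf;
  have [cg dg] := Cg;
  (split=> [x Ux|]; first by apply: continuousM; [exact: cf|exact: cg]) => // i.
have [d1 d2] := df i; have [e1 e2] := dg i.
split=> [x Ux|]; first by apply: derivableM; [exact: d1|exact: e1].
apply: (Ck_eq oU _ (CkD oU (IH _ _ (Ck_le Cf) e2) (IH _ _ (Ck_le Cg) d2))).
by move=> x Ux; rewrite deriveM //; [exact: d1|exact: e1].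
Qed.

End SmoothEuclidean.

Record chart (R : realType) (n : nat) (M : topologicalType) := Chart {
  chart_dom : set M;
  chart_img : set 'rV[R]_n;
  chart_map : M -> 'rV[R]_n;
  chart_inv : 'rV[R]_n -> M;
  chart_dom_open : open chart_dom;
  chart_img_open : open chart_img;
  chart_mapP : forall p, chart_dom p -> chart_img (chart_map p);
  chart_invP : forall x, chart_img x -> chart_dom (chart_inv x);
  chart_mapK : forall p, chart_dom p -> chart_inv (chart_map p) = p;
  chart_invK : forall x, chart_img x -> chart_map (chart_inv x) = x;
  chart_map_cont : forall p, chart_dom p -> {for p, continuous chart_map};
  chart_inv_cont : forall x, chart_img x -> {for x, continuous chart_inv} }.

Arguments chart_dom_open {R n M} c : rename.
Arguments chart_img_open {R n M} c : rename.

HB.mixin Record isSmoothManifold (R : realType) (n : nat) M of Topological M :=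
{ atlas : set (chart R n M);
  manifold_hausdorff : hausdorff_space M;
  manifold_second_countable : @second_countable M;
  atlas_cover : forall p : M, exists2 c, atlas c & chart_dom c p;
  atlas_compat : forall c d, atlas c -> atlas d ->
    smooth_map_on (chart_img c `&` chart_inv c @^-1` chart_dom d)
      (chart_map d \o chart_inv c) }.

#[short(type="smoothManifoldType")]
HB.structure Definition SmoothManifold (R : realType) (n : nat) :=
  { M of isSmoothManifold R n M & Topological M }.

(* The multiplication is tested in the product charts of G * G, whose
   coordinates live in 'rV_(n + n). *)
HB.mixin Record isLieGroup (R : realType) (n : nat) G
    of SmoothManifold R n G & Group G :=
{ lie_mul_cont : continuous (fun p : G * G => (p.1 * p.2)%g);
  lie_inv_cont : continuous (fun p : G => (p^-1)%g);
  lie_mul_smooth : forall c1 c2 d : chart R n G,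
    atlas c1 -> atlas c2 -> atlas d ->
    let m (x : 'rV[R]_(n + n)) :=
      (chart_inv c1 (lsubmx x) * chart_inv c2 (rsubmx x))%g in
    smooth_map_on
      [set x | [/\ chart_img c1 (lsubmx x), chart_img c2 (rsubmx x)
                 & chart_dom d (m x)]]
      (chart_map d \o m);
  lie_inv_smooth : forall c d : chart R n G, atlas c -> atlas d ->
    let i (x : 'rV[R]_n) := ((chart_inv c x)^-1)%g in
    smooth_map_on (chart_img c `&` i @^-1` chart_dom d) (chart_map d \o i) }.

#[short(type="lieGroupType")]
HB.structure Definition LieGroup (R : realType) (n : nat) :=
  { G of isLieGroup R n G & SmoothManifold R n G & Group G }.

Section SmoothFunctions.
Context {R : realType} {n : nat} (M : smoothManifoldType R n).

Definition smooth_fun (f : M -> R) : Prop :=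
  forall c : chart R n M, atlas c -> smooth_on (chart_img c) (f \o chart_inv c).

Definition smooth_pred : {pred M -> R} := fun f => `[< smooth_fun f >].

Record Cinf := MkCinf { Cinf_val :> M -> R; _ : Cinf_val \in smooth_pred }.

HB.instance Definition _ := [isSub for Cinf_val].
HB.instance Definition _ := [Choice of Cinf by <:].

Lemma smooth_cst (a : R) : cst a \in smooth_pred.
Proof. by apply/asboolP => c _ k; exact: (Ck_cst k a (chart_img_open c)). Qed.

Lemma smooth_mul (f g : M -> R) :
  f \in smooth_pred -> g \in smooth_pred -> f * g \in smooth_pred.
Proof.
move=> /asboolP sf /asboolP sg; apply/asboolP => c ac k.
by apply: (CkM (chart_img_open c)); [exact: sf|exact: sg].
Qed.

Lemma smooth_add (f g : M -> R) :
  f \in smooth_pred -> g \in smooth_pred -> f + g \in smooth_pred.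
Proof.
move=> /asboolP sf /asboolP sg; apply/asboolP => c ac k.
by apply: (CkD (chart_img_open c)); [exact: sf|exact: sg].
Qed.

Lemma smooth_scale (a : R) (f : M -> R) :
  f \in smooth_pred -> a *: f \in smooth_pred.
Proof. by move=> sf; apply: (smooth_mul (smooth_cst a)). Qed.

Lemma smooth_subring_closed : subring_closed smooth_pred.
Proof.
split=> [|f g sf sg|f g sf sg]; first exact: smooth_cst.
- by apply: smooth_add => //; rewrite -scaleN1r smooth_scale.
- exact: smooth_mul.
Qed.

HB.instance Definition _ :=
  GRing.isSubringClosed.Build (M -> R) smooth_pred smooth_subring_closed.
HB.instance Definition _ :=
  GRing.isScaleClosed.Build R (M -> R) smooth_pred smooth_scale.

HB.instance Definition _ :=
  GRing.SubChoice_isSubComPzRing.Build (M -> R) smooth_pred Cinf smooth_subring_closed.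
HB.instance Definition _ := [SubZmodule_isSubLmodule of Cinf by <:].

Definition Cinf_cst (a : R) : Cinf := MkCinf (smooth_cst a).

End SmoothFunctions.

Section VectorFields.
Context {R : realType} {n : nat} (M : smoothManifoldType R n).
Local Notation A := (Cinf M).

(* Smooth vector fields are the R-linear derivations of C^oo(M). *)
Definition derivation (X : A -> A) : Prop :=
  (forall (a : R) (f h : A), X (a *: f + h) = a *: X f + X h) /\
  (forall f h : A, X (f * h) = X f * h + f * X h).

Definition derivation_pred : {pred A -> A^o} := fun X => `[< derivation X >].

Record vfield := MkVfield {
  vfield_val :> A -> A^o; _ : vfield_val \in derivation_pred }.

HB.instance Definition _ := [isSub for vfield_val].
HB.instance Definition _ := [Choice of vfield by <:].

Lemma derivationP (X : vfield) : derivation X.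
Proof. by case: X => X /= /asboolP. Qed.

Lemma derivation_submod_closed : submod_closed derivation_pred.
Proof.
split=> [|f X Y /asboolP[Xl Xm] /asboolP[Yl Ym]]; apply/asboolP; split.
- by move=> a f h; rewrite /= scaler0 addr0.
- by move=> f h; rewrite /= mul0r mulr0 addr0.
- move=> a u v; change (f * X (a *: u + v) + Y (a *: u + v) =
    a *: (f * X u + Y u) + (f * X v + Y v)).
  rewrite Xl Yl mulrDr scalerDr.
  have -> : f * (a *: X u) = a *: (f * X u).
    by apply/val_inj/funext => p /=; exact: mulrCA.
  by rewrite addrACA.
- move=> u v; change (f * X (u * v) + Y (u * v) =
    (f * X u + Y u) * v + u * (f * X v + Y v)).
  rewrite Xm Ym !(mulrDr, mulrDl) !mulrA (mulrC f u).
  by rewrite addrACA.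
Qed.

HB.instance Definition _ := GRing.isSubmodClosed.Build A (A -> A^o)
  derivation_pred derivation_submod_closed.
HB.instance Definition _ := [SubChoice_isSubLmodule of vfield by <:].

Lemma bracket_subproof (X Y : vfield) :
  ((fun f => X (Y f) - Y (X f)) : A -> A^o) \in derivation_pred.
Proof.
have [Xl Xm] := derivationP X; have [Yl Ym] := derivationP Y.
have XD f g : X (f + g) = X f + X g.
  by have := Xl 1 f g; rewrite !scale1r.
have YD f g : Y (f + g) = Y f + Y g.
  by have := Yl 1 f g; rewrite !scale1r.
apply/asboolP; split=> [a f h|f h].
- by rewrite Xl Yl Xl Yl scalerBr opprD addrACA.
- by rewrite Xm Ym XD YD !Xm !Ym; ring.
Qed.

Definition bracket (X Y : vfield) : vfield := MkVfield (bracket_subproof X Y).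

(* Global frame: basis of the C^oo(M)-module of vector fields. *)
Definition global_frame (m : nat) (e : 'I_m -> vfield) : Prop :=
  forall X : vfield, exists! a : 'I_m -> A, X = \sum_(i < m) a i *: e i.

End VectorFields.

Section LeftInvariance.
Context {R : realType} {n : nat} (G : lieGroupType R n).

(* X commutes with every left translation L_a; the function h below is the
   pullback f \o L_a. *)
Definition left_invariant (X : vfield G) : Prop :=
  forall (a : G) (f h : Cinf G), (forall p, h p = f (a * p)%g) ->
  forall p, (X h : Cinf G) p = (X f : Cinf G) (a * p)%g.

End LeftInvariance.

Section Geometry.
Context {R : realType} {n : nat} {M : smoothManifoldType R n}.
Local Notation A := (Cinf M).
Local Notation V := (vfield M).

(* Tensor fields are C^oo(M)-multilinear maps on vector fields. *)
Definition pseudo_metric (g : V -> V -> A) : Prop :=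
  [/\ (forall x y, g x y = g y x),
      (forall (f : A) x y z, g (f *: x + y) z = f * g x z + g y z)
    & (forall w : {linear V -> A^o}, exists! x, forall y, w y = g x y)].

Definition almost_contact_Bmetric (phi : {linear V -> V}) (xi : V)
    (eta : {linear V -> A^o}) (g : V -> V -> A) : Prop :=
  [/\ pseudo_metric g,
      (forall x, phi (phi x) = - x + eta x *: xi),
      phi xi = 0,
      (forall x, eta (phi x) = 0)
    & eta xi = 1 /\
      (forall x y, g (phi x) (phi y) = - g x y + eta x * eta y)].

Definition linear_connection (D : V -> V -> V) : Prop :=
  [/\ (forall (f : A) x y z, D (f *: x + y) z = f *: D x z + D y z),
      (forall x y z, D x (y + z) = D x y + D x z)
    & (forall (x : V) (f : A) y, D x (f *: y) = (x f : A) *: y + f *: D x y)].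

Definition levi_civita (g : V -> V -> A) (D : V -> V -> V) : Prop :=
  [/\ linear_connection D,
      (forall x y, D x y - D y x = bracket x y)
    & (forall x y z : V, (x (g y z) : A) = g (D x y) z + g y (D x z))].

Definition cov_endo (D : V -> V -> V) (phi : V -> V) (x y : V) : V :=
  D x (phi y) - phi (D x y).

Definition cov_form (D : V -> V -> V) (eta : V -> A) (x y : V) : A :=
  (x (eta y) : A) - eta (D x y).

Definition phiB_connection (D : V -> V -> V) (phi : V -> V) (xi : V)
    (eta : V -> A) (x y : V) : V :=
  D x y
  + Cinf_cst M (2%:R^-1) *:
      (cov_endo D phi x (phi y) + cov_form D eta x y *: xi)
  - eta y *: D x xi.

Definition curvature (D : V -> V -> V) (x y z : V) : V :=
  D x (D y z) - D y (D x z) - D (bracket x y) z.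

Definition flat (D : V -> V -> V) : Prop :=
  forall x y z, curvature D x y z = 0.

End Geometry.

(* Main.v *)
Require Import Defs.
From HB Require Import structures.
From mathcomp Require Import all_boot all_order all_algebra.
From mathcomp Require Import all_classical all_reals all_analysis.
From mathcomp Require Import ring.

(** Write D for the Levi-Civita connection, D' for the phiB-connection, H for
the span of e_1, ..., e_4.

The structural facts behind the flatness are that [H, H] = 0 and that, with
constant coefficients in an orthonormal frame, H is stable under phi and under
the bracket with xi; [phiB_flat] deduces it from them in any dimension.  They
make D' as simple as possible: D'_x vanishes on all left-invariant fields for
x in H, and D'_xi maps left-invariant horizontal fields to left-invariant
horizontal fields.

Two identities explain this.  First, D' xi = 0, since xi has unit length.
Secondly, when eta y = 0 the definition of D' collapses, because
phi (phi y) = - y, into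

   D'_x y = - 1/2 phi (D_x (phi y) + phi (D_x y))       [phiB_contact]

so that the xi-component of D_x y never contributes.  For left-invariant fields
the Koszul formula involves brackets only; as [H, H] = 0, it says that D_x y is
a multiple of xi for x, y in H, hence D'_x y = 0.  For x = xi it says that the
horizontal part of D_xi y has constant coefficients in the frame.

The curvature is trilinear over smooth functions, so it is enough to evaluate
it on the frame.  The only term that is not obviously zero is
R'(x, xi) z = D'_x (D'_xi z) - D'_xi (D'_x z) - D'_[x, xi] z  with x, z in H,
and there D'_xi z has constant coefficients and [x, xi] is in H, so that all
three terms vanish. *)

Set Implicit Arguments.
Unset Strict Implicit.
Unset Printing Implicit Defensive.

Import Order.TTheory GRing.Theory Num.Theory.
Import numFieldNormedType.Exports.

Local Open Scope classical_set_scope.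
Local Open Scope ring_scope.

(** * Constant functions and the action of vector fields *)

Section ConstantFunctions.
Context {R : realType} {n : nat} {M : smoothManifoldType R n}.
Local Notation A := (Cinf M).
Local Notation V := (vfield M).
Local Notation c := (Cinf_cst M).

(** A constant is a real multiple of the unit: this turns R-linearity of a
derivation into its vanishing on constants. *)
Lemma Cinf_cstE (a : R) : c a = a *: (1 : A).
Proof. by apply/val_inj/funext => p; rewrite /= -[LHS]mulr1. Qed.

Lemma Cinf_cst1 : c 1 = 1.
Proof. by rewrite Cinf_cstE scale1r. Qed.

Lemma Cinf_cst0 : c 0 = 0.
Proof. by rewrite Cinf_cstE scale0r. Qed.

Lemma Cinf_cstD (a b : R) : c (a + b) = c a + c b.
Proof. by rewrite !Cinf_cstE scalerDl. Qed.

Lemma Cinf_cstN (a : R) : c (- a) = - c a.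
Proof. by rewrite !Cinf_cstE scaleNr. Qed.

Lemma Cinf_cstM (a b : R) : c (a * b) = c a * c b.
Proof. by apply/val_inj/funext => p. Qed.

Lemma Cinf_double_inj (f : A) : f + f = 0 -> f = 0.
Proof.
move=> ff0; have -> : f = c 2%:R^-1 * (f + f); last by rewrite ff0 mulr0.
rewrite -[f in f + f]mul1r -mulrDl mulrA -Cinf_cst1 -Cinf_cstD -Cinf_cstM.
by rewrite mulVf ?Cinf_cst1 ?mul1r // pnatr_eq0.
Qed.

Implicit Types (x y z : V) (f h : A).

Lemma vfieldD x f h : (x (f + h) : A) = x f + x h.
Proof. by have := (derivationP x).1 1 f h; rewrite !scale1r. Qed.

Lemma vfieldM x f h : (x (f * h) : A) = (x f : A) * h + f * (x h : A).
Proof. exact: (derivationP x).2. Qed.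

Lemma vfield1 x : (x 1 : A) = 0.
Proof.
have := vfieldM x 1 1; rewrite !mulr1 mul1r.
by move/(congr1 (fun u : A => u - (x 1 : A))); rewrite subrr addrK.
Qed.

Lemma vfield0 x : (x 0 : A) = 0.
Proof. by have := vfieldM x 0 0; rewrite !mulr0 mul0r addr0. Qed.

Lemma vfield_cst x (a : R) : (x (c a) : A) = 0.
Proof.
rewrite Cinf_cstE; have := (derivationP x).1 a 1 0.
by rewrite vfield0 !addr0 => ->; rewrite vfield1 scaler0.
Qed.

(** Identities between vector fields are proved below by evaluating both sides
on a function, which turns them into identities in a commutative ring. *)
Lemma vfieldP x y : (forall f, (x f : A) = y f) -> x = y.
Proof. by move=> xy; apply/val_inj/funext. Qed.

Lemma vfieldDE x y f : ((x + y) f : A) = (x f : A) + (y f : A).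
Proof. by []. Qed.

Lemma vfieldZE h x f : ((h *: x) f : A) = h * (x f : A).
Proof. by []. Qed.

Lemma vfieldNE x f : ((- x) f : A) = - (x f : A).
Proof. by []. Qed.

Lemma bracketE x y f : (bracket x y f : A) = (x (y f : A) : A) - (y (x f : A) : A).
Proof. by []. Qed.

Definition vfieldE := (bracketE, vfieldDE, vfieldZE, vfieldNE).

Lemma bracketN x y : bracket y x = - bracket x y.
Proof. by apply/vfieldP => f; rewrite !vfieldE opprB. Qed.

Lemma bracketDl f x x' y :
  bracket (f *: x + x') y = f *: bracket x y - (y f : A) *: x + bracket x' y.
Proof. by apply/vfieldP => h; rewrite !vfieldE vfieldD vfieldM; ring. Qed.

End ConstantFunctions.

(** * Tensoriality of the curvature *)

Section LinearConnections.
Context {R : realType} {n : nat} {M : smoothManifoldType R n}.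
Local Notation A := (Cinf M).
Local Notation V := (vfield M).
Local Notation c := (Cinf_cst M).
Implicit Types (x y z : V) (f h : A).

Lemma conn0l (D : V -> V -> V) z : linear_connection D -> D 0 z = 0.
Proof.
case=> Dl _ _; have := Dl (-1) 0 0 z.
by rewrite scaler0 addr0 scaleN1r addNr.
Qed.

Lemma conn0r (D : V -> V -> V) x : linear_connection D -> D x 0 = 0.
Proof.
case=> _ Dr _; have := Dr x 0 0; rewrite addr0.
by move/(congr1 (fun v => v - D x 0)); rewrite subrr addrK.
Qed.

Lemma connNr (D : V -> V -> V) x y : linear_connection D -> D x (- y) = - D x y.
Proof.
move=> HD; apply/eqP; rewrite -addr_eq0; case: (HD) => _ Dr _.
by rewrite -Dr addNr conn0r.
Qed.

Lemma conn_cst (D : V -> V -> V) x y (a : R) :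
  linear_connection D -> D x (c a *: y) = c a *: D x y.
Proof. by case=> _ _ DL; rewrite DL vfield_cst scale0r add0r. Qed.

Lemma curvature_antisym (D : V -> V -> V) x y z :
  linear_connection D -> curvature D y x z = - curvature D x y z.
Proof.
case=> Dl Dr DL; rewrite /curvature bracketN.
have -> : D (- bracket x y) z = - D (bracket x y) z.
  by have := Dl (-1) (bracket x y) 0 z; rewrite !scaleN1r addr0 conn0l ?addr0.
by apply/vfieldP => h; rewrite !vfieldE; ring.
Qed.

(** The derivatives of [f] produced by D_y (f D_x z) cancel against the term
- (y f) x of the bracket. *)
Lemma curvature_linearl (D : V -> V -> V) f x x' y z : linear_connection D ->
  curvature D (f *: x + x') y z = f *: curvature D x y z + curvature D x' y z.
Proof.
case=> Dl Dr DL; rewrite /curvature.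
have -> : bracket (f *: x + x') y =
    f *: bracket x y + ((- (y f : A)) *: x + bracket x' y).
  by rewrite bracketDl scaleNr -addrA.
rewrite !Dl Dr DL; apply/vfieldP => h.
by rewrite !vfieldE; ring.
Qed.

(** The second derivatives of [f] add up to ([x, y] f) z, which is the Leibniz
term of D_[x, y]. *)
Lemma curvature_linearr (D : V -> V -> V) f x y z z' : linear_connection D ->
  curvature D x y (f *: z + z') = f *: curvature D x y z + curvature D x y z'.
Proof.
case=> Dl Dr DL; rewrite /curvature.
rewrite !(Dr, DL); apply/vfieldP => h.
by rewrite !vfieldE; ring.
Qed.

Variables (m : nat) (e : 'I_m -> V).

(** The frame is kept in two parts, the [e i] and one more field [xi], since
in an almost contact structure these play different roles. *)
Definition spans_with (xi : V) :=
  forall v, exists a : 'I_m -> A, exists b : A, v = \sum_i a i *: e i + b *: xi.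

Lemma spans_with_ind (xi : V) (P : V -> Prop) : spans_with xi ->
  (forall f x y, P x -> P y -> P (f *: x + y)) ->
  (forall i, P (e i)) -> P xi -> forall v, P v.
Proof.
move=> sp Pl Pe Pxi v; have [a [b ->]] := sp v.
have P0 : P 0 by rewrite -(addNr xi) -scaleN1r; exact: Pl.
rewrite addrC; apply: (Pl) => //; apply: (big_ind P) => // [x y Px Py|i _].
  by rewrite -[x]scale1r; exact: Pl.
by rewrite -[_ *: _]addr0; exact: Pl.
Qed.

(** By tensoriality the curvature is determined on the frame; antisymmetry
leaves the pairs (e_i, e_j) and (e_i, xi). *)
Lemma flat_frame (D : V -> V -> V) (xi : V) : spans_with xi ->
  linear_connection D ->
  (forall i j k, curvature D (e i) (e j) (e k) = 0) ->
  (forall i k, curvature D (e i) xi (e k) = 0) ->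
  (forall i j, curvature D (e i) (e j) xi = 0) ->
  (forall i, curvature D (e i) xi xi = 0) ->
  flat D.
Proof.
move=> sp HD Reee Rexe Reex Rexx.
have Rxx z : curvature D xi xi z = 0.
  have bxx : bracket xi xi = 0 by apply/vfieldP => f; rewrite vfieldE subrr.
  by rewrite /curvature bxx subrr conn0l // subr0.
have lr x y : (forall k, curvature D x y (e k) = 0) -> curvature D x y xi = 0 ->
    forall z, curvature D x y z = 0.
  move=> H1 H2; apply: (spans_with_ind sp) => // f z z' Hz Hz'.
  by rewrite curvature_linearr // Hz Hz' scaler0 addr0.
move=> x y z; move: x; apply: (spans_with_ind sp).
- by move=> f x x' Hx Hx'; rewrite curvature_linearl // Hx Hx' scaler0 addr0.
- move=> i; rewrite curvature_antisym //; apply/eqP; rewrite oppr_eq0; apply/eqP.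
  move: y; apply: (spans_with_ind sp).
  + by move=> f y y' Hy Hy'; rewrite curvature_linearl // Hy Hy' scaler0 addr0.
  + by move=> j; exact: lr.
  + by rewrite curvature_antisym // lr ?oppr0.
- move: y; apply: (spans_with_ind sp) => // [f y y' Hy Hy'|j].
    rewrite curvature_antisym // curvature_linearl //.
    rewrite (curvature_antisym xi y) // (curvature_antisym xi y') //.
    by rewrite Hy Hy' !oppr0 scaler0 addr0 oppr0.
  by rewrite curvature_antisym // lr ?oppr0.
Qed.

(** When the [e i] are independent left-invariant fields on a Lie group, these
are the left-invariant fields among their combinations. *)
Definition const_span (v : V) := exists a : 'I_m -> R, v = \sum_i c (a i) *: e i.

Lemma const_span_lin (a : R) x y :
  const_span x -> const_span y -> const_span (c a *: x + y).
Proof.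
move=> [b ->] [b' ->]; exists (fun i => a * b i + b' i).
rewrite scaler_sumr -big_split; apply: eq_bigr => i _ /=.
by rewrite Cinf_cstD Cinf_cstM scalerDl scalerA.
Qed.

Lemma const_span_frame i : const_span (e i).
Proof.
exists (fun j => (j == i)%:R); rewrite (bigD1 i) //= eqxx Cinf_cst1 scale1r.
by rewrite big1 ?addr0 // => j /negPf ->; rewrite Cinf_cst0 scale0r.
Qed.

Lemma const_span0 : const_span 0.
Proof.
by exists (fun=> 0); rewrite big1 // => i _; rewrite Cinf_cst0 scale0r.
Qed.

Lemma const_spanZ (a : R) x : const_span x -> const_span (c a *: x).
Proof. by rewrite -[_ *: _]addr0 => Hx; apply: const_span_lin const_span0. Qed.

Lemma const_spanD x y : const_span x -> const_span y -> const_span (x + y).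
Proof. by move=> Hx; rewrite -[x]scale1r -Cinf_cst1; exact: const_span_lin. Qed.

Lemma const_spanN x : const_span x -> const_span (- x).
Proof. by rewrite -scaleN1r -Cinf_cst1 -Cinf_cstN; exact: const_spanZ. Qed.

Lemma const_span_ind (P : V -> Prop) : P 0 ->
  (forall (a : R) x y, P x -> P y -> P (c a *: x + y)) ->
  (forall i, P (e i)) -> forall v, const_span v -> P v.
Proof.
move=> P0 Pl Pe v [a ->]; apply: (big_rec P) => // i x _ Px; exact: Pl.
Qed.

End LinearConnections.

(** * The phiB-connection of an almost contact B-metric structure *)

Section AlmostContactBMetric.
Context {R : realType} {n : nat} {M : smoothManifoldType R n}.
Local Notation A := (Cinf M).
Local Notation V := (vfield M).
Local Notation c := (Cinf_cst M).
Implicit Types (x y z : V) (f h : A).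

Variables (phi : {linear V -> V}) (xi : V) (eta : {linear V -> A^o}).
Variables (g : V -> V -> A) (nabla : V -> V -> V).
Hypothesis acB : almost_contact_Bmetric phi xi eta g.
Hypothesis LC : levi_civita g nabla.

Let gC x y : g x y = g y x.
Proof. by have [[gC _ _] _ _ _ _] := acB. Qed.

Let gP f x y z : g (f *: x + y) z = f * g x z + g y z.
Proof. by have [[_ gP _] _ _ _ _] := acB. Qed.

Let g0 z : g 0 z = 0.
Proof. by have := gP (-1) 0 0 z; rewrite scaler0 addr0 mulN1r addNr. Qed.

Let gD x y z : g (x + y) z = g x z + g y z.
Proof. by rewrite -[x in LHS]scale1r gP mul1r. Qed.

Let gZ f x z : g (f *: x) z = f * g x z.
Proof. by rewrite -[f *: x]addr0 gP g0 addr0. Qed.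

Let gN x z : g (- x) z = - g x z.
Proof. by rewrite -scaleN1r gZ mulN1r. Qed.

Let etaP f x y : (eta (f *: x + y) : A) = f * (eta x : A) + (eta y : A).
Proof. exact: linearP. Qed.

Let etaD x y : (eta (x + y) : A) = (eta x : A) + (eta y : A).
Proof. exact: linearD. Qed.

Let etaZ f x : (eta (f *: x) : A) = f * (eta x : A).
Proof. by have := etaP f x 0; rewrite addr0 linear0 addr0. Qed.

Let phiP f x y : phi (f *: x + y) = f *: phi x + phi y.
Proof. exact: linearP. Qed.

Let phiD x y : phi (x + y) = phi x + phi y.
Proof. exact: linearD. Qed.

Let phiZ f x : phi (f *: x) = f *: phi x.
Proof. by rewrite linearZ. Qed.

Let phi2 x : phi (phi x) = - x + (eta x : A) *: xi.
Proof. by have [_ phi2 _ _ _] := acB; exact: phi2. Qed.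

Let phixi : phi xi = 0.
Proof. by have [] := acB. Qed.

Let etaxi : (eta xi : A) = 1.
Proof. by have [_ _ _ _ []] := acB. Qed.

Let LCconn : linear_connection nabla.
Proof. by have [] := LC. Qed.

Lemma metric_xi x : g x xi = eta x.
Proof.
have [_ _ _ _ [_ gphi]] := acB.
have := gphi x xi; rewrite phixi gC g0 etaxi mulr1.
by move/eqP; rewrite eq_sym addrC subr_eq0 => /eqP <-.
Qed.

(** Koszul formula, without the derivative terms: they vanish for fields whose
scalar products are constant. *)
Lemma koszul_const x y z :
  (x (g y z) : A) = 0 -> (y (g z x) : A) = 0 -> (z (g x y) : A) = 0 ->
  g (nabla x y) z + g (nabla x y) z =
    g (bracket x y) z + g (bracket z x) y + g (bracket z y) x.
Proof.
have [_ tf mc] := LC.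
rewrite !mc -!tf !gD !gN (gC y) (gC z) (gC x) => H1 H2 H3.
apply/eqP; rewrite -subr_eq0; apply/eqP; rewrite -[RHS]addr0.
(* By symmetry of the metric, the difference of the two sides is the sum of the
   left sides of H1 and H2, minus that of H3. *)
rewrite -{1}H1 -(subrr 0) -{1}H2 -H3; ring.
Qed.

Lemma phiB_linear_connection :
  linear_connection (phiB_connection nabla phi xi eta).
Proof.
have [Dl Dr DL] := LCconn.
rewrite /phiB_connection /cov_endo /cov_form.
split=> [f x y z|x y z|x f y].
- by rewrite !Dl !phiP etaP; apply/vfieldP => h; rewrite !vfieldE; ring.
- rewrite !(phiD, Dr, etaD, vfieldD).
  by apply/vfieldP => h; rewrite !vfieldE; ring.
- rewrite !(phiZ, DL, phiP, etaZ, etaP, vfieldM).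
  by apply/vfieldP => h; rewrite !vfieldE; ring.
Qed.

Let half : c 2%:R^-1 + c 2%:R^-1 = 1.
Proof. by rewrite -Cinf_cstD -Cinf_cst1 [in RHS](splitr 1) mul1r. Qed.

(** Since phi (phi y) = - y, the definition gives 1/2 (w - eta w xi) -
1/2 phi (D_x (phi y)) with w = D_x y, and w - eta w xi = - phi (phi w). *)
Lemma phiB_contact x y : (eta y : A) = 0 ->
  phiB_connection nabla phi xi eta x y =
  - c 2%:R^-1 *: phi (nabla x (phi y) + phi (nabla x y)).
Proof.
move=> etay; rewrite /phiB_connection /cov_endo /cov_form.
rewrite phiD !phi2 etay vfield0 !scale0r subr0 addr0 (connNr _ _ LCconn).
rewrite -[X in X + _]scale1r -half.
by apply/vfieldP => h; rewrite !vfieldE; ring.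
Qed.

(** The correction - eta y D_x xi cancels D_x xi, and the term in the
derivative of eta vanishes because xi has constant length. *)
Lemma phiB_xi x : phiB_connection nabla phi xi eta x xi = 0.
Proof.
have [_ _ mc] := LC.
have e0 : (eta (nabla x xi) : A) = 0.
  apply: Cinf_double_inj; have := mc x xi xi.
  by rewrite (gC xi) !metric_xi etaxi vfield1 => <-.
rewrite /phiB_connection /cov_endo /cov_form phixi linear0 conn0r // linear0.
by rewrite e0 etaxi vfield1 !subr0 scale0r addr0 scaler0 addr0 scale1r subrr.
Qed.

(** * Flatness for an abelian ideal of horizontal fields *)

Variables (m : nat) (e : 'I_m -> V) (eps : 'I_m -> R).
Hypothesis eps2 : forall i, eps i * eps i = 1.
Hypothesis gee : forall i, g (e i) (e i) = c (eps i).
Hypothesis gij : forall i j, i != j -> g (e i) (e j) = 0.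
Hypothesis etae : forall i, (eta (e i) : A) = 0.
Hypothesis spe : spans_with e xi.

Lemma frame_expansion v :
  v = \sum_i (c (eps i) * g v (e i)) *: e i + (eta v : A) *: xi.
Proof.
have [a [b vE]] := spe v.
have etav : (eta v : A) = b.
  rewrite vE linearD linear_sum big1 => [|i _]; last first.
    by rewrite etaZ etae mulr0.
  by rewrite add0r etaZ etaxi mulr1.
rewrite etav {1}vE; congr (_ + _); apply: eq_bigr => i _; congr (_ *: _).
rewrite vE gD gZ (gC xi) metric_xi etae mulr0 addr0.
rewrite (big_morph (g^~ (e i)) (fun x y => gD x y (e i)) (g0 (e i))).
rewrite (bigD1 i) //= big1 => [|j ji]; last by rewrite gZ gij // mulr0.
by rewrite addr0 gZ gee mulrCA -Cinf_cstM eps2 Cinf_cst1 mulr1.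
Qed.

Lemma const_span_expansion v : (forall i, exists a, g v (e i) = c a) ->
  exists2 u, const_span e u & v = u + (eta v : A) *: xi.
Proof.
move=> /choice[a aE].
exists (\sum_i c (eps i * a i) *: e i); first by exists (fun i => eps i * a i).
rewrite {1}[v]frame_expansion; congr (_ + _).
by apply: eq_bigr => i _; rewrite aE Cinf_cstM.
Qed.

Hypothesis bre : forall i j, bracket (e i) (e j) = 0.
Hypothesis brxi : forall i, const_span e (bracket (e i) xi).
Hypothesis phie : forall i, const_span e (phi (e i)).

Let gcst i j : exists a, g (e i) (e j) = c a.
Proof.
have [->|ij] := eqVneq i j; first by exists (eps j).
by exists 0; rewrite gij // Cinf_cst0.
Qed.

Let gcst_span v j : const_span e v -> exists a, g v (e j) = c a.
Proof.
move: v; apply: const_span_ind => [|a x y [b Hb] [b' Hb']|i].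
- by exists 0; rewrite g0 Cinf_cst0.
- by exists (a * b + b'); rewrite gP Hb Hb' Cinf_cstD Cinf_cstM.
- exact: gcst.
Qed.

Let dg x i j : (x (g (e i) (e j)) : A) = 0.
Proof. by have [a ->] := gcst i j; rewrite vfield_cst. Qed.

Let dgxi x i : (x (g (e i) xi) : A) = 0.
Proof. by rewrite metric_xi etae vfield0. Qed.

Lemma const_span_phi v : const_span e v -> const_span e (phi v).
Proof.
move: v; apply: const_span_ind => [|a x y Hx Hy|i] //.
- by rewrite linear0; exact: const_span0.
- by rewrite phiP; exact: const_span_lin.
Qed.

(** All brackets in the Koszul formula for D_(e_i) e_j against e_k vanish, so
D_(e_i) e_j is a multiple of xi, which phi kills. *)
Lemma phi_nabla_frame i v : const_span e v -> phi (nabla (e i) v) = 0.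
Proof.
have [_ Dr _] := LCconn.
move: v; apply: const_span_ind => [|a x y Hx Hy|j].
- by rewrite conn0r // linear0.
- by rewrite Dr conn_cst // phiP Hx Hy scaler0 addr0.
have gn k : g (nabla (e i) (e j)) (e k) = 0.
  by apply: Cinf_double_inj; rewrite koszul_const ?dg // !bre !g0 !addr0.
rewrite [nabla _ _]frame_expansion big1 => [|k _]; last first.
  by rewrite gn mulr0 scale0r.
by rewrite add0r phiZ phixi scaler0.
Qed.

(** The Koszul formula makes the scalar products of D_xi e_j with the frame
constant; phi removes the xi-component. *)
Lemma phi_nabla_xi v : const_span e v -> const_span e (phi (nabla xi v)).
Proof.
have [_ Dr _] := LCconn.
move: v; apply: const_span_ind => [|a x y Hx Hy|j].
- by rewrite conn0r // linear0; exact: const_span0.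
- by rewrite Dr conn_cst // phiP; exact: const_span_lin.
have gn k : exists a, g (nabla xi (e j)) (e k) = c a.
  have [a aE] := gcst_span k (brxi j); have [b bE] := gcst_span j (brxi k).
  exists (2%:R^-1 * (b - a)); rewrite -[LHS]mul1r -half mulrDl -mulrDr.
  rewrite koszul_const ?dg ?dgxi //; last by rewrite gC dgxi.
  by rewrite bre g0 addr0 bracketN gN aE bE addrC Cinf_cstM Cinf_cstD Cinf_cstN.
have [u Hu ->] := const_span_expansion gn.
by rewrite phiD phiZ phixi scaler0 addr0; exact: const_span_phi.
Qed.

Local Notation D' := (phiB_connection nabla phi xi eta).

(** Both D'_(e_i) and D'_[e_i, xi] kill the constant-coefficient fields e_k and
D'_xi e_k, so every term of R'(e_i, xi) e_k vanishes. *)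
Theorem phiB_flat : flat D'.
Proof.
have D'conn : linear_connection D' := phiB_linear_connection.
have [D'l D'r _] := D'conn.
have D'xi x : D' x xi = 0 by exact: phiB_xi.
have D'ee i j : D' (e i) (e j) = 0.
  rewrite phiB_contact // phiD phi_nabla_frame; last exact: phie.
  by rewrite phi_nabla_frame ?linear0 ?addr0 ?scaler0 //; exact: const_span_frame.
have D'ev i v : const_span e v -> D' (e i) v = 0.
  move: v; apply: const_span_ind => [|a x y Hx Hy|j] //; first exact: conn0r.
  by rewrite D'r conn_cst // Hx Hy scaler0 addr0.
have D've v j : const_span e v -> D' v (e j) = 0.
  move: v; apply: const_span_ind => [|a x y Hx Hy|i] //; first exact: conn0l.
  by rewrite D'l Hx Hy scaler0 addr0.
have D'xie j : const_span e (D' xi (e j)).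
  rewrite phiB_contact // -Cinf_cstN phiD; apply/const_spanZ/const_spanD.
    exact/phi_nabla_xi/phie.
  exact/const_span_phi/phi_nabla_xi/const_span_frame.
apply: (flat_frame spe) => // [i j k|i k|i j|i]; rewrite /curvature.
- by rewrite !D'ee bre conn0l // !conn0r // !subrr.
- by rewrite D'ee conn0r // D'ev // D've // !subrr.
- by rewrite !D'xi !conn0r // !subrr.
- by rewrite !D'xi !conn0r // !subrr.
Qed.

End AlmostContactBMetric.

Theorem proposition4p2 (R : realType) (G : lieGroupType R 5)
  (l1 l2 l3 l4 m1 m3 : R)
  (e1 e2 e3 e4 e5 : vfield G)
  (phi : {linear vfield G -> vfield G}) (xi : vfield G)
  (eta : {linear vfield G -> (Cinf G)^o})
  (g : vfield G -> vfield G -> Cinf G)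
  (nabla : vfield G -> vfield G -> vfield G) :
  let e := tnth [tuple e1; e2; e3; e4; e5] in
  let c := @Cinf_cst R 5 G in
  connected [set: G] ->
  (forall i, left_invariant (e i)) ->
  global_frame e ->
  almost_contact_Bmetric phi xi eta g ->
  [/\ phi e1 = e3, phi e2 = e4, phi e3 = - e1, phi e4 = - e2 & phi e5 = 0] ->
  xi = e5 ->
  [/\ eta e1 = 0, eta e2 = 0, eta e3 = 0, eta e4 = 0 & eta e5 = 1] ->
  [/\ g e1 e1 = 1, g e2 e2 = 1, g e3 e3 = - 1, g e4 e4 = - 1 & g e5 e5 = 1] ->
  (forall i j, i != j -> g (e i) (e j) = 0) ->
  bracket e1 xi = c l1 *: e1 + c l2 *: e2 + c l3 *: e3 + c l4 *: e4 ->
  bracket e2 xi = c m1 *: e1 - c l1 *: e2 + c m3 *: e3 - c l3 *: e4 ->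
  bracket e3 xi = - c l3 *: e1 - c l4 *: e2 + c l1 *: e3 + c l2 *: e4 ->
  bracket e4 xi = - c m3 *: e1 + c l3 *: e2 + c m1 *: e3 - c l1 *: e4 ->
  (forall i j : 'I_4, bracket (tnth [tuple e1; e2; e3; e4] i)
                              (tnth [tuple e1; e2; e3; e4] j) = 0) ->
  levi_civita g nabla ->
  flat (phiB_connection nabla phi xi eta).
Proof.
move=> e c _ _ frame acB [phi1 phi2 phi3 phi4 _] xiE [eta1 eta2 eta3 eta4 _].
move=> [g1 g2 g3 g4 _] gij br1 br2 br3 br4 br LC.
pose h := tnth [tuple e1; e2; e3; e4].
have eh i : e (widen_ord (leqnSn 4) i) = h i.
  by rewrite /e /h !(tnth_nth 0); case: i => [[|[|[|[|]]]]].
have [h1 h2 h3 h4] : [/\ const_span h e1, const_span h e2, const_span h e3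
                       & const_span h e4].
  by split; [have := const_span_frame h (inord 0)
            |have := const_span_frame h (inord 1)
            |have := const_span_frame h (inord 2)
            |have := const_span_frame h (inord 3)];
     rewrite {2}/h (tnth_nth 0) inordK.
have spanZ (a : R) x : const_span h x -> const_span h (c a *: x).
  exact: const_spanZ.
apply: (@phiB_flat _ _ _ _ _ _ _ _ acB LC 4 h
          (fun i => nth 0 [:: 1; 1; - 1; - 1] i)) => //.
- by case=> [[|[|[|[|//]]]] lti] /=; rewrite ?mulrNN mulr1.
- by case=> [[|[|[|[|//]]]] lti]; rewrite /h (tnth_nth 0) /=
    ?Cinf_cstN Cinf_cst1.
- by move=> i j ij; rewrite -!eh gij // (inj_eq val_inj).
- by case=> [[|[|[|[|//]]]] lti]; rewrite /h (tnth_nth 0).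
- move=> v; have [a [vE _]] := frame v.
  exists (fun i => a (widen_ord (leqnSn 4) i)), (a ord_max).
  rewrite vE big_ord_recr /= xiE; congr (_ + _).
  by apply: eq_bigr => i _; rewrite eh.
- by case=> [[|[|[|[|//]]]] lti]; rewrite /h (tnth_nth 0) /= ?br1 ?br2 ?br3 ?br4
    -?Cinf_cstN; do !apply: const_spanD; try apply: const_spanN; exact: spanZ.
- case=> [[|[|[|[|//]]]] lti]; rewrite /h (tnth_nth 0) /= ?phi1 ?phi2 ?phi3 ?phi4 //;
  exact: const_spanN.
Qed.
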